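(* There exists $n_0\in\mathbb{N}$ such that for all $n\ge n_0$ the following holds. If $\mathcal{A}\subset S_n$ is a family of permutations such that no two permutations in $\mathcal{A}$ agree at exactly one point, then $|\mathcal{A}|\le (n-2)!$, and equality holds only if $\mathcal{A}$ is a $2$-coset of $S_n$.
   Context: $S_n$ is the symmetric group on $[n]=\{1,\dots,n\}$. Two permutations $\sigma,\tau\in S_n$ agree at exactly $k$ points if $\#\{i\in[n]:\sigma(i)=\tau(i)\}=k$. A $2$-coset of $S_n$ is a coset of the pointwise stabiliser of two points, i.e. a set of the form $\{\sigma\in S_n:\sigma(i)=j,\ \sigma(k)=l\}$ with $i\neq k$, $j\neq l$. *)

(* Defs.v *)
From HB Require Import structures.
From mathcomp Require Import all_boot all_order all_fingroup.
Set Implicit Arguments. Unset Strict Implicit. Unset Printing Implicit Defensive.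

Definition agree_count (n : nat) (s t : {perm 'I_n}) : nat :=
  #|[set i : 'I_n | s i == t i]|.

Definition two_coset (n : nat) (A : {set {perm 'I_n}}) : Prop :=
  exists (i k j l : 'I_n), i != k /\ j != l /\
    A = [set s : {perm 'I_n} | (s i == j) && (s k == l)].

(* Main.v *)
Require Import Defs.
From HB Require Import structures.
From mathcomp Require Import all_boot all_order all_fingroup all_algebra.
From mathcomp Require Import ring lra zify.

Set Implicit Arguments. Unset Strict Implicit. Unset Printing Implicit Defensive.
Import GRing.Theory Num.Theory Order.TTheory.

(** View a permutation as its graph, an [n]-subset of the [n * n] cells.  For a
    set [S] of cells, call a nonempty subfamily [B] of the coset of [S] spread if
    prescribing [k <= 4] further cells cuts [B] down by a factor at most
    [(c / n) ^ k], with [c] a constant slightly above 1.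

    Two spread families, over [S] and [T], look random to each other: the number
    of common cells (outside [S] and [T]) of a random pair has factorial moments
    close to those of a Poisson variable of parameter 1, so by Bonferroni's
    inequalities it takes each of the values 0 and 1 with positive probability.
    If [#|S :&: T| <= 1] this produces a pair agreeing exactly once.

    Hence in a family [A] with no such pair, the sets [S] over which [A] contains
    a spread subfamily pairwise share at least two cells.  A density increment
    argument shows that those of size at most [q], of order [n ^ (1/3)], have
    cosets covering all of [A] but at most [(n - 2)! / 100] permutations.  Either
    all these [S] contain a common pair of cells, or their cosets have at most
    [q ^ 3 * (n - 3)!] elements altogether.  In the first case [A] is nearly
    contained in a 2-coset, and a permutation of [A] outside that 2-coset would
    exclude from [A] a positive proportion of it, again by Bonferroni. *)

(** * Permutations as sets of cells *)

Notation cell n := ('I_n * 'I_n)%type.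

Definition graph n (s : {perm 'I_n}) : {set cell n} := [set p | s p.1 == p.2].

Definition ext n (A : {set {perm 'I_n}}) (X : {set cell n}) : {set {perm 'I_n}} :=
  [set s in A | X \subset graph s].

Lemma graphE n (s : {perm 'I_n}) : graph s = (fun i => (i, s i)) @: [set: 'I_n].
Proof.
apply/setP=> -[i j]; rewrite inE /=; apply/eqP/imsetP; last by case=> k _ [-> ->].
by move=> <-; exists i; rewrite ?inE.
Qed.

Lemma graph_fst_inj n (s : {perm 'I_n}) : {in graph s &, injective fst}.
Proof. by move=> [i j] [k l]; rewrite !inE /= => /eqP<- /eqP<- ->. Qed.

Lemma graph_snd_inj n (s : {perm 'I_n}) : {in graph s &, injective snd}.
Proof.
move=> [i j] [k l]; rewrite !inE /= => /eqP<- /eqP<- H.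
by rewrite (perm_inj H).
Qed.

Lemma card_graph n (s : {perm 'I_n}) : #|graph s| = n.
Proof. by rewrite graphE card_imset ?cardsT ?card_ord // => i j []. Qed.

Lemma card_graphI n (s t : {perm 'I_n}) : #|graph s :&: graph t| = agree_count s t.
Proof.
rewrite /agree_count -(@card_imset _ _ (fun i => (i, s i))) => [|i j []//].
apply: eq_card => -[i j]; rewrite !inE /=; apply/idP/imsetP.
  case/andP=> /eqP<- /eqP e; exists i => //; by rewrite inE e.
by case=> k; rewrite inE => /eqP e [-> ->]; rewrite eqxx e eqxx.
Qed.

Lemma extS n (A B : {set {perm 'I_n}}) X : A \subset B -> ext A X \subset ext B X.
Proof.
by move=> sAB; apply/subsetP=> s; rewrite !inE => /andP[/(subsetP sAB)-> ->].
Qed.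

Lemma ext_sub n (A : {set {perm 'I_n}}) X : ext A X \subset A.
Proof. by apply/subsetP=> s; rewrite inE => /andP[]. Qed.

Lemma extU n (A : {set {perm 'I_n}}) X Y : ext (ext A X) Y = ext A (X :|: Y).
Proof. by apply/setP=> s; rewrite !inE subUset andbA. Qed.

(** Right multiplication by [s] maps the permutations fixing every row of [X] bijectively onto the
    coset of [X]. *)
Lemma card_extT n (s : {perm 'I_n}) (X : {set cell n}) : X \subset graph s ->
  #|ext [set: {perm 'I_n}] X| = (n - #|X|)`!.
Proof.
move=> sX.
have Einj : {in X &, injective fst}.
  by move=> p q /(subsetP sX) hp /(subsetP sX) hq; apply: graph_fst_inj hp hq.
have <- : #|~: (fst @: X)| = n - #|X|.
  by rewrite cardsCs setCK card_in_imset // card_ord.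
rewrite -card_perm -(card_imset (perm_on _) (mulIg s)); apply: eq_card => t.
rewrite !inE; apply/idP/imsetP => [sXt|[u hu ->]].
  exists (t * s^-1)%g; last by rewrite mulgKV.
  apply/subsetP=> i; rewrite !inE; apply: contra => /imsetP[p pX ->].
  have:= subsetP sX _ pX; have:= subsetP sXt _ pX; rewrite !inE => /eqP h1 /eqP h2.
  by rewrite permM h1 -h2 permK.
apply/subsetP=> p pX; rewrite inE permM (out_perm hu).
  by have:= subsetP sX _ pX; rewrite inE.
by rewrite inE negbK; apply/imsetP; exists p.
Qed.

Lemma card_ext_le n (A : {set {perm 'I_n}}) X : #|ext A X| <= (n - #|X|)`!.
Proof.
case: (set_0Vmem (ext A X)) => [->|[s]]; first by rewrite cards0.
rewrite inE => /andP[_ sX]; rewrite -(card_extT sX).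
by apply/subset_leq_card/extS/subsetT.
Qed.

(** Double counting of pairs of a permutation and a [k]-subset of its graph inside [Z]. *)
Lemma sum_bin_graph n (A : {set {perm 'I_n}}) (Z : {set cell n}) k :
  \sum_(s in A) 'C(#|graph s :&: Z|, k) =
  \sum_(X : {set cell n} | (X \subset Z) && (#|X| == k)) #|ext A X|.
Proof.
under eq_bigr => s _ do rewrite -cards_draws -sum1_card.
under [RHS]eq_bigr => X _ do rewrite -sum1_card.
rewrite (exchange_big_dep (fun X : {set cell n} => (X \subset Z) && (#|X| == k))) /=; last first.
  by move=> s X _; rewrite !inE subsetI -andbA => /and3P[_ -> ->].
apply: eq_bigr => X /andP[h1 h2]; apply: eq_bigl => s.
by rewrite !inE subsetI h1 h2 !andbT.
Qed.

Lemma sum_bin_graph2 n (B C : {set {perm 'I_n}}) (Z : {set cell n}) k :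
  \sum_(u in setX B C) 'C(#|graph u.1 :&: graph u.2 :&: Z|, k) =
  \sum_(X : {set cell n} | (X \subset Z) && (#|X| == k)) #|ext B X| * #|ext C X|.
Proof.
under eq_bigr => s _ do rewrite -cards_draws -sum1_card.
under [RHS]eq_bigr => X _ do rewrite -cardsX -sum1_card.
rewrite (exchange_big_dep (fun X : {set cell n} => (X \subset Z) && (#|X| == k))) /=; last first.
  by move=> s X _; rewrite !inE !subsetI -!andbA => /and4P[_ _ -> ->].
apply: eq_bigr => X /andP[h1 h2]; apply: eq_bigl => -[s t] /=.
by rewrite !inE !subsetI h1 h2 !andbT /= andbACA.
Qed.

(** * Bonferroni's inequalities *)

(* Small enough that the Bonferroni sums, which are 1/3 for a Poisson variable of
   parameter 1, stay above 1/10.  Locked, since unification would otherwise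
   normalise its powers in rat. *)
HB.lock Definition slack : rat := (51 / 50)%R.
Notation slackE := slack.unlock.

Section Bonferroni.
Local Open Scope ring_scope.

(** For [N = M + 1] the alternating sum telescopes to [- 'C(M, 3)]. *)
Lemma bonferroni0 (N : nat) :
  1 - N%:R + 'C(N, 2)%:R - 'C(N, 3)%:R <= (N == 0)%:R :> rat.
Proof.
case: N => [|M]; first by rewrite !bin0n /=; lra.
rewrite (binS M 2) (binS M 1) bin1 !natrD -(natr1 M) /=.
have : 0 <= 'C(M, 3)%:R :> rat by [].
lra.
Qed.

(** Since [k * 'C(N, k) = N * 'C(N - 1, k - 1)], this is the previous inequality for [N - 1],
    multiplied by [N]. *)
Lemma bonferroni1 (N : nat) :
  N%:R - 2 * 'C(N, 2)%:R + 3 * 'C(N, 3)%:R - 4 * 'C(N, 4)%:R <= (N == 1)%:R :> rat.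
Proof.
case: N => [|M]; first by rewrite !bin0n /=; lra.
have E k : k.+1%:R * 'C(M.+1, k.+1)%:R = M.+1%:R * 'C(M, k)%:R :> rat.
  by rewrite -!natrM -mul_bin_diag.
have H := bonferroni0 M.
have M1 : 0 <= M.+1%:R :> rat by [].
have H2 := ler_wpM2l M1 H.
have := E 1; have := E 2; have := E 3; rewrite !bin1.
have -> : (M.+1 == 1) = (M == 0) by [].
have e : M.+1%:R * (M == 0)%:R = (M == 0)%:R :> rat by case: (M) => [|m]; rewrite /= -natrM ?muln0.
rewrite e in H2; move: H2; rewrite !(mulrBr, mulrDr, mulr1). lra.
Qed.

Lemma slack_ge0 : 0 <= slack.
Proof. by rewrite slackE; lra. Qed.

Lemma slack_powers : [/\ slack ^+ (2 * 1) <= 1041 / 1000,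
  slack ^+ (2 * 2) <= 1084 / 1000, slack ^+ (2 * 3) <= 1128 / 1000 &
  slack ^+ (2 * 4) <= 1172 / 1000].
Proof. by rewrite slackE; split; lra. Qed.

Lemma poisson_zero (p y1 y2 y3 S1 S2 S3 T : rat) : 0 <= p ->
  y1 <= 1041 / 1000 * p -> y2 <= 1084 / 1000 * p -> y3 <= 1128 / 1000 * p ->
  S1 <= y1 -> 2 * p - y2 <= 2 * S2 -> 6 * S3 <= y3 ->
  p - S1 + S2 - S3 <= T -> p / 10 <= T.
Proof. lra. Qed.

(** The tighter of the two cases: the coefficients leave about [0.116 * p], against [0.229 * p]
    above. *)
Lemma poisson_one (p y1 y2 y3 y4 S1 S2 S3 S4 T : rat) : 0 <= p ->
  y1 <= 1041 / 1000 * p -> y2 <= 1084 / 1000 * p -> y3 <= 1128 / 1000 * p ->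
  y4 <= 1172 / 1000 * p ->
  2 * p - y1 <= S1 -> 2 * S2 <= y2 -> 2 * p - y3 <= 6 * S3 -> 24 * S4 <= y4 ->
  S1 - 2 * S2 + 3 * S3 - 4 * S4 <= T -> p / 10 <= T.
Proof. lra. Qed.

(* The factorial moments of a Poisson variable of parameter 1 all equal 1;
   such a variable takes each of the values 0 and 1 with probability 1/e. *)
Lemma poisson_moments (I : finType) (P : {set I}) (N : I -> nat) (r : nat) :
  (forall k, (0 < k <= 4)%N ->
    2 * #|P|%:R - slack ^+ (2 * k) * #|P|%:R <= k`!%:R * \sum_(i in P) 'C(N i, k)%:R
                                 <= slack ^+ (2 * k) * #|P|%:R) ->
  (r <= 1)%N -> #|P|%:R / 10 <= #|[set i in P | N i == r]|%:R :> rat.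
Proof.
move=> H r1.
have -> : #|[set i in P | N i == r]|%:R = \sum_(i in P) (N i == r)%:R :> rat.
  rewrite -sum1_card natr_sum (eq_bigl (fun i => (i \in P) && (N i == r))); last first.
    by move=> i; rewrite inE.
  by rewrite big_mkcondr; apply: eq_bigr => i _; case: eqP.
have b0 : #|P|%:R - \sum_(i in P) 'C(N i, 1)%:R + \sum_(i in P) 'C(N i, 2)%:R
    - \sum_(i in P) 'C(N i, 3)%:R <= \sum_(i in P) (N i == 0)%:R :> rat.
  rewrite -sum1_card natr_sum -!sumrN -!big_split /=; apply: ler_sum => i _.
  by rewrite bin1; apply: bonferroni0.
have b1 : \sum_(i in P) 'C(N i, 1)%:R - 2 * (\sum_(i in P) 'C(N i, 2)%:R)
    + 3 * (\sum_(i in P) 'C(N i, 3)%:R) - 4 * (\sum_(i in P) 'C(N i, 4)%:R)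
    <= \sum_(i in P) (N i == 1)%:R :> rat.
  rewrite !mulr_sumr -!sumrN -!big_split /=; apply: ler_sum => i _.
  by rewrite bin1; apply: bonferroni1.
have P0 : 0 <= #|P|%:R :> rat by [].
have /andP[l1 u1] := H 1%N isT; have /andP[l2 u2] := H 2%N isT.
have /andP[l3 u3] := H 3%N isT; have /andP[l4 u4] := H 4%N isT.
have f2 : 2`! = 2%N by []. have f3 : 3`! = 6%N by []. have f4 : 4`! = 24%N by [].
have f1 : 1`! = 1%N by [].
rewrite f1 in l1 u1; rewrite f2 in l2 u2; rewrite f3 in l3 u3; rewrite f4 in l4 u4.
rewrite mul1r in l1 u1.
have d k x : slack ^+ (2 * k) <= x -> slack ^+ (2 * k) * #|P|%:R <= x * #|P|%:R.
  by apply: ler_wpM2r.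
have [d1 d2 d3 d4] := slack_powers.
move: {d1 d2 d3 d4} (d _ _ d1) (d _ _ d2) (d _ _ d3) (d _ _ d4) => d1 d2 d3 d4.
move: r1 {H d}; rewrite leq_eqVlt ltnS leqn0 => /orP[]/eqP->; last first.
  exact: poisson_zero P0 d1 d2 d3 u1 l2 u3 b0.
exact: poisson_one P0 d1 d2 d3 d4 l1 u2 l3 u4 b1.
Qed.

End Bonferroni.

(** * Spread families *)

Lemma leq_ffact_exp m k : m ^_ k <= m ^ k.
Proof.
elim: k m => [|k IH] m; first by rewrite ffactn0 expn0.
rewrite ffactnS expnS leq_mul2l; apply/orP; right.
apply: leq_trans (IH _) _; case: k {IH} => [|k]; first by rewrite !expn0.
by rewrite leq_exp2r // leq_pred.
Qed.

Lemma leq_exp_ffact m k : (m - k) ^ k <= m ^_ k.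
Proof.
elim: k m => [|k IH] m; first by rewrite ffactn0 expn0.
rewrite ffactnS expnS leq_mul ?leq_subr //.
by apply: leq_trans (IH _); rewrite subnS -subn1 subnAC subn1.
Qed.

(** A graph containing [U] has all its other cells in [far U], as the rows and columns of [U] are
    used up. *)
Definition far n (U : {set cell n}) : {set cell n} :=
  [set p | (p.1 \notin fst @: U) && (p.2 \notin snd @: U)].

Lemma far_disjoint n (U X : {set cell n}) : X \subset far U -> [disjoint X & U].
Proof.
move=> sX; rewrite disjoint_subset; apply/subsetP=> p /(subsetP sX).
rewrite !inE => /andP[h _]; apply: contra h => pU; exact: imset_f.
Qed.

Lemma card_graph_far n (s : {perm 'I_n}) (U : {set cell n}) : n - 2 * #|U| <= #|graph s :&: far U|.
Proof.
rewrite -{1}(card_graph s) -(cardsID (far U) (graph s)) leq_subLR addnC leq_add2r.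
have sub : graph s :\: far U \subset
    (fun i => (i, s i)) @: (fst @: U) :|: (fun j => (s^-1 j, j)%g) @: (snd @: U).
  apply/subsetP=> -[i j]; rewrite !inE /= negb_and !negbK => /andP[h /eqP e].
  case/orP: h => h; apply/orP; [left|right]; apply/imsetP.
    by exists i => //; rewrite e.
  by exists j => //; rewrite -e permK.
apply: leq_trans (subset_leq_card sub) _.
apply: leq_trans (leq_card_setU _ _) _.
rewrite mul2n -addnn leq_add //; apply: leq_trans (leq_imset_card _ _) _; exact: leq_imset_card.
Qed.

Lemma card_far n (U : {set cell n}) : #|far U| <= n ^ 2.
Proof.
by apply: leq_trans (max_card _) _; rewrite card_prod card_ord -mulnn.
Qed.

Section Spread.
Local Open Scope ring_scope.

(** Up to four cells, because the Bonferroni sums involve the first four binomial moments. *)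
Definition spread n (B : {set {perm 'I_n}}) (S : {set cell n}) : bool :=
  [forall X : {set cell n}, [disjoint X & S] ==> (#|X| <= 4)%N ==>
    (#|ext B X|%:R <= (slack / n%:R) ^+ #|X| * #|B|%:R)].

Lemma spreadP n (B : {set {perm 'I_n}}) (S : {set cell n}) :
  reflect (forall X : {set cell n}, [disjoint X & S] -> (#|X| <= 4)%N ->
             #|ext B X|%:R <= (slack / n%:R) ^+ #|X| * #|B|%:R)
          (spread B S).
Proof.
apply: (iffP forallP) => h X; last by apply/implyP=> hd; apply/implyP; apply: h.
by move=> hd hX; have /implyP/(_ hd)/implyP/(_ hX) := h X.
Qed.

(** The second hypothesis amounts to [n <= slack * (n - m - 4)]. *)
Lemma large_ffact n m k : (0 < n)%N -> (102 * (m + 4) <= 2 * n)%N -> (k <= 4)%N ->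
  (1 <= (slack / n%:R) ^+ k * ((n - m) ^_ k)%:R).
Proof.
move=> n0 hm k4.
have h : (1 <= (slack / n%:R) * (n - m - k)%:R).
  rewrite mulrAC ler_pdivlMr ?ltr0n // mul1r slackE.
  have : (100 * n <= 102 * (n - m - k))%N by lia.
  by rewrite -(ler_nat rat) !natrM; lra.
apply: le_trans (exprn_ege1 k h) _.
rewrite exprMn; apply: ler_wpM2l; first by rewrite exprn_ge0 ?divr_ge0 ?slack_ge0.
by rewrite -natrX ler_nat leq_exp_ffact.
Qed.

(** The upper bound multiplies the two hypotheses and counts the sets [X]. The lower bound follows
    from the same hypotheses: on average the parts through [X] nearly reach the permitted maximum,
    so it suffices to sum over [X] the product of the two deficits, which is nonnegative. *)
Lemma pair_moments n (B C : {set {perm 'I_n}}) (U : {set cell n}) k :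
  (0 < n)%N -> (102 * (2 * #|U| + 4) <= 2 * n)%N -> (k <= 4)%N ->
  (forall X : {set cell n}, X \subset far U -> #|X| = k ->
     #|ext B X|%:R <= (slack / n%:R) ^+ k * #|B|%:R) ->
  (forall X : {set cell n}, X \subset far U -> #|X| = k ->
     #|ext C X|%:R <= (slack / n%:R) ^+ k * #|C|%:R) ->
  2 * #|setX B C|%:R - slack ^+ (2 * k) * #|setX B C|%:R
    <= k`!%:R * \sum_(u in setX B C) 'C(#|graph u.1 :&: graph u.2 :&: far U|, k)%:R
    <= slack ^+ (2 * k) * #|setX B C|%:R.
Proof.
move=> n0 hU k4 hB hC.
rewrite -natr_sum sum_bin_graph2 natr_sum.
under eq_bigr => X _ do rewrite natrM.
rewrite cardsX natrM; set a := (slack / n%:R) ^+ k in hB hC *.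
set Q := fun X : {set cell n} => (X \subset far U) && (#|X| == k).
have a0 : 0 <= a by rewrite exprn_ge0 ?divr_ge0 ?slack_ge0.
have cardQ : \sum_(X | Q X) 1 = 'C(#|far U|, k)%:R :> rat.
  by rewrite -cards_draws -sum1_card natr_sum; apply: eq_bigl => X; rewrite inE.
have total : k`!%:R * 'C(#|far U|, k)%:R * a ^+ 2 <= slack ^+ (2 * k).
  have -> : slack ^+ (2 * k) = (n ^ (2 * k))%:R * a ^+ 2.
    rewrite /a -exprM mulnC exprMn mulrCA natrX -exprMn divff ?expr1n ?mulr1 //.
    by rewrite pnatr_eq0 -lt0n.
  apply: ler_wpM2r; first exact: exprn_ge0.
  rewrite -natrM ler_nat mulnC bin_ffact.
  apply: leq_trans (leq_ffact_exp _ _) _; rewrite expnM.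
  by case: (k) => // k'; rewrite leq_exp2r // card_far.
(* Every graph meets [far U] in at least [n - 2 * #|U|] cells, so the parts of [A] have a large
   sum. *)
have low (A : {set {perm 'I_n}}) : #|A|%:R <= a * (k`!%:R * \sum_(X | Q X) #|ext A X|%:R).
  rewrite -natr_sum -sum_bin_graph -natrM.
  have : (#|A| * (n - 2 * #|U|) ^_ k <= k`! * \sum_(s in A) 'C(#|graph s :&: far U|, k))%N.
    rewrite -sum_nat_const big_distrr; apply: leq_sum => s _ /=.
    by rewrite -bin_ffact mulnC leq_mul2l leq_bin2l ?orbT // card_graph_far.
  rewrite -(ler_nat rat) => h; apply: le_trans (ler_wpM2l a0 h).
  rewrite natrM mulrCA -[X in X <= _]mulr1; apply: ler_wpM2l => //.
  exact: large_ffact.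
have b0 : 0 <= #|B|%:R :> rat by []. have c0 : 0 <= #|C|%:R :> rat by [].
have k0 : 0 <= k`!%:R :> rat by [].
apply/andP; split; last first.
  apply: le_trans (ler_wpM2r (mulr_ge0 b0 c0) total).
  rewrite -!mulrA; apply: ler_wpM2l => //.
  rewrite -cardQ mulr_suml; apply: ler_sum => X /andP[sX /eqP cX].
  rewrite mul1r mulrA mulrACA; apply: ler_pM => //; [exact: hB|exact: hC].
(* [(a b - b_X) (a c - c_X) >= 0], where [b_X] and [c_X] are the sizes of the
   parts of B and C through X *)
have pt X : Q X -> a * #|B|%:R * #|ext C X|%:R + a * #|C|%:R * #|ext B X|%:R
   - a ^+ 2 * (#|B|%:R * #|C|%:R) * 1 <= #|ext B X|%:R * #|ext C X|%:R.
  case/andP=> sX /eqP cX.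
  have h1 : 0 <= a * #|B|%:R - #|ext B X|%:R by rewrite subr_ge0 hB.
  have h2 : 0 <= a * #|C|%:R - #|ext C X|%:R by rewrite subr_ge0 hC.
  have := mulr_ge0 h1 h2; rewrite -subr_ge0.
  move=> h; rewrite -subr_ge0; congr (0 <= _): h; ring.
have := ler_sum (index_enum _) pt.
rewrite sumrB big_split /= -!mulr_sumr cardQ => h.
apply: le_trans (ler_wpM2l k0 h).
have lB := ler_wpM2r c0 (low B). have lC := ler_wpM2l b0 (low C).
have t := ler_wpM2r (mulr_ge0 b0 c0) total.
move: lB lC t; move: (\sum_(X | Q X) #|ext C X|%:R) (\sum_(X | Q X) #|ext B X|%:R) => x y.
move: (slack ^+ _) (k`!%:R) ('C(_, _)%:R) (#|B|%:R) (#|C|%:R) => s f z b c lB lC t.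
have e : f * (a * b * x + a * c * y - a ^+ 2 * (b * c) * z) =
  b * (a * (f * x)) + a * (f * y) * c - f * z * a ^+ 2 * (b * c) by ring.
rewrite e; lra.
Qed.

End Spread.

(** * Pairs agreeing exactly once *)

Lemma leq_card_bigcup (I T : finType) (P : pred I) (F : I -> {set T}) :
  #|\bigcup_(i | P i) F i| <= \sum_(i | P i) #|F i|.
Proof.
elim/big_ind2: _ => [|A a B b hA hB|//]; first by rewrite cards0.
by apply: leq_trans (leq_card_setU _ _) (leq_add hA hB).
Qed.

(** A common cell in a row or column of [S] or [T] must be the cell of that set there; disjointness
    then puts it in both sets. *)
Lemma graphI_split n (s t : {perm 'I_n}) (S T : {set cell n}) :
  S \subset graph s -> T \subset graph t ->
  [disjoint graph s & T :\: S] -> [disjoint graph t & S :\: T] ->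
  agree_count s t = #|graph s :&: graph t :&: far (S :|: T)| + #|S :&: T|.
Proof.
move=> sS tT dST dTS.
rewrite -card_graphI -(cardsID (far (S :|: T)) (graph s :&: graph t)).
congr (_ + _); apply: eq_card => p; apply/idP/idP; last first.
  rewrite inE => /andP[pS pT]; rewrite !inE imset_f ?inE ?pS //=.
  by move: (subsetP sS _ pS) (subsetP tT _ pT); rewrite !inE => -> ->.
rewrite in_setD in_setI => /and3P[hfar ps pt].
have pU : (p \in S) || (p \in T).
  rewrite inE negb_and !negbK in hfar.
  case/orP: hfar => /imsetP[p']; rewrite inE => /orP[] hp' e; apply/orP.
  - by left; rewrite (graph_fst_inj ps (subsetP sS _ hp') e).
  - by right; rewrite (graph_fst_inj pt (subsetP tT _ hp') e).
  - by left; rewrite (graph_snd_inj ps (subsetP sS _ hp') e).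
  - by right; rewrite (graph_snd_inj pt (subsetP tT _ hp') e).
have := disjointFr dST ps; have := disjointFr dTS pt.
by move: pU; rewrite !inE; case: (p \in S); case: (p \in T).
Qed.

Section Quasirandom.
Local Open Scope ring_scope.

(** Union bound for the pairs whose first member meets [T :\: S]: at most [q] cells, each costing a
    factor [slack / n]. *)
Lemma few_meeting n (B C : {set {perm 'I_n}}) (S T : {set cell n}) q :
  (1000 * (q + 1) <= n)%N -> (#|T| <= q)%N -> spread B S ->
  (\sum_(p in T :\: S) #|ext B [set p]| * #|C|)%:R <= (#|B| * #|C|)%:R / 100 :> rat.
Proof.
move=> hn hT /spreadP hB; rewrite natr_sum.
have n0 : 0 < n%:R :> rat by rewrite ltr0n; lia.
have b0 : 0 <= #|B|%:R :> rat by []. have c0 : 0 <= #|C|%:R :> rat by [].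
apply: le_trans (_ : \sum_(p in T :\: S) slack / n%:R * (#|B|%:R * #|C|%:R) <= _).
  apply: ler_sum => p; rewrite inE => /andP[pS pT].
  rewrite natrM mulrA; apply: ler_wpM2r => //.
  have := hB [set p]; rewrite cards1 expr1; apply => //.
  by rewrite disjoints1.
rewrite sumr_const -mulrnAl natrM [leRHS]mulrC; apply: ler_wpM2r; first exact: mulr_ge0.
have hle : (#|T :\: S| <= q)%N by apply: leq_trans hT; apply/subset_leq_card/subsetDl.
rewrite -mulr_natl mulrA (ler_pdivrMr _ _ n0) slackE.
have h2 : (1000 * #|T :\: S| <= n)%N by lia.
rewrite -(ler_nat rat) natrM in h2.
have := ler0n rat #|T :\: S|.
move: (#|T :\: S|%:R) (n%:R) h2 => x y; lra.
Qed.

(** At least a tenth of the pairs have [1 - #|S :&: T|] common cells in [far U]. At most two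
    hundredths lie in [E1] or [E2]; outside these, the far cells and [S :&: T] account for all
    agreements. *)
Lemma exists_agree1 n q (B C : {set {perm 'I_n}}) (S T : {set cell n}) :
  (1000 * (q + 1) <= n)%N -> (#|S| <= q)%N -> (#|T| <= q)%N ->
  B != set0 -> C != set0 ->
  {in B, forall s, S \subset graph s} -> {in C, forall s, T \subset graph s} ->
  spread B S -> spread C T -> (#|S :&: T| <= 1)%N ->
  exists s t, [/\ s \in B, t \in C & agree_count s t = 1%N].
Proof.
move=> hn hS hT B0 C0 sB sC hB hC hST.
pose U := S :|: T.
have cU : (#|U| <= 2 * q)%N by apply: leq_trans (leq_card_setU _ _) _; lia.
pose N (u : {perm 'I_n} * {perm 'I_n}) := #|graph u.1 :&: graph u.2 :&: far U|.
pose G := [set u in setX B C | N u == (1 - #|S :&: T|)%N].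
have hG : #|setX B C|%:R / 10 <= #|G|%:R :> rat.
  apply: poisson_moments; last by rewrite leq_subr.
  move: (hB) (hC) => /spreadP sprB /spreadP sprC.
  move=> k /andP[k0 k4]; apply: pair_moments; [lia|lia|by []| |].
    move=> X sX cX; rewrite -cX; apply: sprB; last by rewrite cX.
    by apply: disjointWr (far_disjoint sX); apply: subsetUl.
  move=> X sX cX; rewrite -cX; apply: sprC; last by rewrite cX.
  by apply: disjointWr (far_disjoint sX); apply: subsetUr.
pose E1 := \bigcup_(p in T :\: S) setX (ext B [set p]) C.
pose E2 := \bigcup_(p in S :\: T) setX B (ext C [set p]).
have hE1 : #|E1|%:R <= #|setX B C|%:R / 100 :> rat.
  rewrite cardsX; apply: le_trans (few_meeting C hn hT hB); rewrite ler_nat.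
  apply: leq_trans (leq_card_bigcup _ _) _.
  by under eq_bigr => p _ do rewrite cardsX.
have hE2 : #|E2|%:R <= #|setX B C|%:R / 100 :> rat.
  rewrite cardsX mulnC; apply: le_trans (few_meeting B hn hS hC); rewrite ler_nat.
  apply: leq_trans (leq_card_bigcup _ _) _.
  by under eq_bigr => p _ do rewrite cardsX mulnC.
have P0 : 0 < #|setX B C|%:R :> rat.
  by rewrite ltr0n cardsX muln_gt0 !card_gt0 B0 C0.
have : ~~ (G \subset E1 :|: E2).
  apply/negP=> /subset_leq_card h.
  have := leq_trans h (leq_card_setU _ _).
  by rewrite -(ler_nat rat) natrD; lra.
case/subsetPn=> -[s t]; rewrite inE in_setX in_setU negb_or.
move=> /andP[/andP[/= sBs tCt] /eqP Nst] /andP[nE1 nE2].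
exists s, t; split=> //.
have d1 : [disjoint graph s & T :\: S].
  rewrite disjoint_sym disjoint_subset; apply/subsetP=> p hp; apply: contra nE1 => ps.
  by apply/bigcupP; exists p; rewrite // !inE sBs tCt sub1set ps.
have d2 : [disjoint graph t & S :\: T].
  rewrite disjoint_sym disjoint_subset; apply/subsetP=> p hp; apply: contra nE2 => ps.
  by apply/bigcupP; exists p; rewrite // !inE sBs tCt sub1set ps.
rewrite (graphI_split (sB _ sBs) (sC _ tCt) d1 d2) -/U.
by move: Nst; rewrite /N /= => ->; rewrite subnK.
Qed.

End Quasirandom.

(** * Density increment *)

(* The room between [tau] and [slack] absorbs the difference between powers and
   falling factorials. *)
HB.lock Definition tau : rat := (101 / 100)%R.
Notation tauE := tau.unlock.

Section Increment.
Local Open Scope ring_scope.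

Lemma tau_gt0 : 0 < tau.
Proof. by rewrite tauE; lra. Qed.

Lemma tau_ge1 : 1 <= tau.
Proof. by rewrite tauE; lra. Qed.

Lemma tau_slack n m : (102 * m <= n)%N -> tau * n%:R <= slack * (n - m)%:R.
Proof.
move=> h; have : (101 * n <= 102 * (n - m))%N by lia.
by rewrite -(ler_nat rat) !natrM tauE slackE; lra.
Qed.

(* The relative density of A in the coset of S, discounted by tau ^ #|S|. *)
Definition weight n (A : {set {perm 'I_n}}) (S : {set cell n}) : rat :=
  #|ext A S|%:R / ((n - #|S|)`!%:R * tau ^+ #|S|).

(** Adding [X] to [S] cannot increase the weight, so the proportion through [X] is at most
    [tau ^+ #|X|] over a falling factorial. *)
Lemma max_weight_spread n (A : {set {perm 'I_n}}) (S : {set cell n}) :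
  (102 * (#|S| + 4) <= n)%N -> (forall Y, weight A Y <= weight A S) ->
  spread (ext A S) S.
Proof.
move=> hn maxS; apply/spreadP=> X dXS k4; rewrite extU.
have cU : #|S :|: X| = (#|S| + #|X|)%N.
  by rewrite cardsU setIC disjoint_setI0 // cards0 subn0.
have n0 : 0 < n%:R :> rat by rewrite ltr0n; lia.
have t0 := tau_gt0.
have F m : 0 < m`!%:R :> rat by rewrite ltr0n fact_gt0.
have := maxS (S :|: X); rewrite /weight cU.
have e : (n - #|S|)`! = ((n - #|S|) ^_ #|X| * (n - (#|S| + #|X|))`!)%N.
  by rewrite subnDA ffact_fact //; lia.
rewrite e exprD natrM ler_pdivrMr ?mulr_gt0 ?exprn_gt0 // mulrAC.
set f := (_ - _)`!%:R; set g := (_ ^_ _)%:R; set x := #|ext A (S :|: X)|%:R; set y := #|ext A S|%:R.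
have g0 : 0 < g by rewrite ltr0n ffact_gt0; lia.
have f0 : 0 < f by exact: F.
have ts : 0 < tau ^+ #|S| by rewrite exprn_gt0.
have -> : y * (f * (tau ^+ #|S| * tau ^+ #|X|)) / (g * f * tau ^+ #|S|) = y * tau ^+ #|X| / g.
  by field; rewrite !gt_eqF.
rewrite ler_pdivlMr // => h.
have key : (tau * n%:R) ^+ #|X| <= slack ^+ #|X| * g.
  have h1 : tau * n%:R <= slack * (n - (#|S| + #|X|))%:R by apply: tau_slack; lia.
  apply: le_trans (_ : (slack * (n - (#|S| + #|X|))%:R) ^+ #|X| <= _).
    by apply: lerXn2r; rewrite ?nnegrE ?h1 ?mulr_ge0 ?slack_ge0 ?ler0n ?(ltW t0).
  rewrite exprMn; apply: ler_wpM2l; first by rewrite exprn_ge0 ?slack_ge0.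
  by rewrite -natrX ler_nat subnDA leq_exp_ffact.
have tn : 0 < (tau * n%:R) ^+ #|X| by rewrite exprn_gt0 ?mulr_gt0.
have x0 : 0 <= x by [].
rewrite -(ler_pM2r tn) expr_div_n exprMn.
have -> : slack ^+ #|X| / n%:R ^+ #|X| * y * (tau ^+ #|X| * n%:R ^+ #|X|) =
    slack ^+ #|X| * (y * tau ^+ #|X|).
  by field; rewrite expf_neq0 // gt_eqF.
apply: le_trans (_ : x * (slack ^+ #|X| * g) <= _).
  by rewrite -exprMn; apply: ler_wpM2l.
by rewrite mulrCA; apply: ler_wpM2l => //; rewrite exprn_ge0 ?slack_ge0.
Qed.

(** A set of maximal weight works. Its weight is at least that of the empty set, which exceeds
    [1 / (100 * n ^ 2)], while the density in a coset is at most 1; hence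
    [tau ^+ #|S| < 100 * n ^ 2]. *)
Lemma exists_spread n q (A : {set {perm 'I_n}}) :
  (1000 * (q + 1) <= n)%N -> (100 * n ^ 2)%:R <= tau ^+ q ->
  ((n - 2)`! < 100 * #|A|)%N ->
  exists S : {set cell n}, [/\ (#|S| <= q)%N, ext A S != set0 & spread (ext A S) S].
Proof.
move=> hn hq hA.
case: (arg_maxP (weight A) (erefl : xpredT (set0 : {set cell n}))) => S _ maxS.
have F m : 0 < m`!%:R :> rat by rewrite ltr0n fact_gt0.
have t0 := tau_gt0.
have A0 : (0 < #|A|)%N by lia.
have w0 : #|A|%:R / n`!%:R <= weight A S.
  have -> : #|A|%:R / n`!%:R = weight A set0; last exact: maxS.
  have eA : ext A set0 = A by apply/setP=> s; rewrite inE sub0set andbT.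
  by rewrite /weight eA cards0 subn0 expr0 mulr1.
have nz : ext A S != set0.
  apply/eqP=> h; move: w0; rewrite /weight h cards0 mul0r leNgt.
  by rewrite divr_gt0 // ltr0n.
have lt_tau : tau ^+ #|S| < (100 * n ^ 2)%:R.
  have h1 : tau ^+ #|S| * #|A|%:R <= n`!%:R.
    rewrite mulrC -ler_pdivlMr ?exprn_gt0 // [leRHS]mulrC -ler_pdivrMr //.
    apply: le_trans w0 _; rewrite /weight ler_pdivrMr ?mulr_gt0 ?exprn_gt0 //.
    by rewrite mulrCA mulVf ?gt_eqF ?exprn_gt0 // mulr1 ler_nat card_ext_le.
  have h2 : (n`! < 100 * n ^ 2 * #|A|)%N.
    have -> : n`! = (n * (n.-1 * (n - 2)`!))%N.
      have [m ->] : (exists m, n = m.+2)%N by exists (n - 2)%N; lia.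
      by rewrite !factS subn2.
    nia.
  rewrite -(ltr_pM2r (_ : 0 < #|A|%:R)) ?ltr0n //; apply: le_lt_trans h1 _.
  by rewrite -natrM ltr_nat.
have hS : (#|S| <= q)%N.
  rewrite leqNgt; apply/negP=> /ltnW h.
  have := lt_le_trans lt_tau hq; rewrite ltNge => /negP; apply.
  exact: (ler_weXn2l tau_ge1 h).
exists S; split=> //; apply: max_weight_spread; first by lia.
by move=> Y; apply: maxS.
Qed.

End Increment.

(** * Covering a family by cosets *)

(** [B] may be smaller than [ext A S], so that a spread part of the uncovered remainder also yields
    a core of [A]. *)
Definition cores n (A : {set {perm 'I_n}}) (q : nat) : {set {set cell n}} :=
  [set S : {set cell n} | (#|S| <= q) && [exists B : {set {perm 'I_n}},
     [&& B != set0, B \subset ext A S & spread B S]]].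

Lemma remainder_small n q (A : {set {perm 'I_n}}) :
  1000 * (q + 1) <= n -> ((100 * n ^ 2)%:R <= tau ^+ q)%R ->
  100 * #|A :\: \bigcup_(S in cores A q) ext [set: {perm 'I_n}] S| <= (n - 2)`!.
Proof.
move=> hn hq; set R := A :\: _; rewrite leqNgt; apply/negP=> hR.
have [S [cS nz spr]] := exists_spread hn hq hR.
have Score : S \in cores A q.
  rewrite inE cS; apply/existsP; exists (ext R S); rewrite nz spr andbT.
  by apply/extS/subsetDl.
have /set0Pn[s] := nz; rewrite !inE => /andP[/andP[/bigcupP h _] sS].
by apply: h; exists S => //; rewrite !inE.
Qed.

Lemma cores_intersect n q (A : {set {perm 'I_n}}) :
  1000 * (q + 1) <= n ->
  (forall s t, s \in A -> t \in A -> agree_count s t != 1) ->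
  {in cores A q &, forall S T : {set cell n}, 2 <= #|S :&: T|}.
Proof.
move=> hn hA S T; rewrite !inE => /andP[cS /existsP[B /and3P[B0 sB sprB]]].
case/andP=> cT /existsP[C /and3P[C0 sC sprC]].
rewrite ltnNge; apply/negP=> hST.
have gB : {in B, forall s, S \subset graph s}.
  by move=> s /(subsetP sB); rewrite inE => /andP[].
have gC : {in C, forall s, T \subset graph s}.
  by move=> s /(subsetP sC); rewrite inE => /andP[].
have [s [t [sBs tCt st1]]] := exists_agree1 hn cS cT B0 C0 gB gC sprB sprC hST.
have sA := subsetP (ext_sub A S) _ (subsetP sB _ sBs).
have tA := subsetP (ext_sub A T) _ (subsetP sC _ tCt).
by have := hA _ _ sA tA; rewrite st1.
Qed.

(** If no pair lies in every member, fix [S1]. Each member [S] contains a pair [x] of cells of [S1];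
    as it shares two cells with a member not containing [x], it also contains a cell of that member
    outside [x]. This leaves at most [q ^ 3] triples. *)
Lemma two_intersecting_cover n q (F : {set {set cell n}}) :
  {in F, forall S : {set cell n}, #|S| <= q} ->
  {in F &, forall S T : {set cell n}, 2 <= #|S :&: T|} ->
  (exists2 x : {set cell n}, #|x| = 2 & {in F, forall S : {set cell n}, x \subset S}) \/
  #|\bigcup_(S in F) ext [set: {perm 'I_n}] S| <= q ^ 3 * (n - 3)`!.
Proof.
move=> hq h2.
case: (boolP [exists x : {set cell n}, (#|x| == 2) && [forall S in F, x \subset S]]).
  by case/existsP=> x /andP[/eqP cx /forall_inP hx]; left; exists x.
rewrite negb_exists => /forallP hx; right.
case: (set_0Vmem F) => [->|[S1 S1F]]; first by rewrite big_set0 cards0.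
(* The default [S1] keeps [miss x] in [F]; for a pair [x] the search succeeds by [hx]. *)
pose miss (x : {set cell n}) := odflt S1 [pick S in F | ~~ (x \subset S)].
have missF x : miss x \in F.
  by rewrite /miss; case: pickP => //= S /andP[].
have missN (x : {set cell n}) : #|x| = 2 -> ~~ (x \subset miss x).
  move=> cx; rewrite /miss; case: pickP => [S /andP[]//|none].
  have := hx x; rewrite cx eqxx /= => /negP[]; apply/forall_inP=> S SF.
  by have := none S; rewrite SF /= => /negbFE.
pose W := \bigcup_(p in S1) \bigcup_(p' in S1 :\ p)
  \bigcup_(y in miss [set p; p'] :\: [set p; p']) ext [set: {perm 'I_n}] (y |: [set p; p']).
have sub : \bigcup_(S in F) ext [set: {perm 'I_n}] S \subset W.
  apply/bigcupsP=> S SF; apply/subsetP=> s; rewrite !inE /= => sS.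
  have /card_gt1P[p [p' [hp hp' pp']]] := h2 _ _ SF S1F.
  move: hp hp'; rewrite !inE => /andP[pS pS1] /andP[p'S p'S1].
  set x := [set p; p'].
  have cx : #|x| = 2 by rewrite cards2 pp'.
  have [y yS ynx] : exists2 y, y \in S :&: miss x & y \notin x.
    apply/subsetPn; apply/negP=> sx.
    have e : S :&: miss x = x by apply/eqP; rewrite eqEcard sx cx h2.
    by have := missN _ cx; rewrite -{1}e subsetIr.
  apply/bigcupP; exists p => //; apply/bigcupP; exists p'; first by rewrite !inE eq_sym pp'.
  move: yS; rewrite inE => /andP[yS ym].
  apply/bigcupP; exists y; first by rewrite in_setD ynx.
  rewrite !inE /=; apply: subset_trans sS; apply/subsetP=> z.
  by rewrite !inE => /or3P[]/eqP->.
apply: leq_trans (subset_leq_card sub) _.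
apply: leq_trans (leq_card_bigcup _ _) _.
have bound (I : finType) (D : {set I}) (f : I -> nat) m : #|D| <= q ->
    {in D, forall i, f i <= m} -> \sum_(i in D) f i <= q * m.
  move=> hD hf; apply: leq_trans (_ : \sum_(i in D) m <= _); first exact: leq_sum.
  by rewrite sum_nat_const leq_mul2r hD orbT.
rewrite !expnS expn0 muln1 -!mulnA; apply: (bound); first exact: hq.
move=> p pS1; apply: leq_trans (leq_card_bigcup _ _) _; apply: (bound).
  by apply: leq_trans (hq _ S1F); apply/subset_leq_card/subsetDl.
move=> p' p'S1; apply: leq_trans (leq_card_bigcup _ _) _; apply: (bound).
  by apply: leq_trans (hq _ (missF [set p; p'])); apply/subset_leq_card/subsetDl.
move=> y; rewrite inE => /andP[ynx _]; apply: leq_trans (card_ext_le _ _) _.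
by move: p'S1; rewrite !inE => /andP[p'p _]; rewrite cardsU1 ynx cards2 eq_sym p'p.
Qed.

(** * Exponential against polynomial growth *)

Lemma exp_beats_poly e c d : exists q0, forall q, q0 <= q ->
  c * (q + 2) ^ d * e ^ q <= e.+1 ^ q.
Proof.
(* The summand [2 * D + 2] ensures [q + 2 <= 2 * (q - D)]; the last one makes the spare factor
   [q - D] absorb the constants. *)
pose D := d.+1; exists (2 * D + 2 + D`! * c * 2 ^ d * e ^ D) => q hq.
have Dq : D <= q by lia.
(* One term of the binomial expansion suffices: its coefficient has degree [d + 1] in [q]. *)
have h1 : 'C(q, D) * e ^ (q - D) <= e.+1 ^ q.
  rewrite -addn1 expnDn (bigD1 (inord D)) //= inordK ?ltnS // exp1n muln1.
  exact: leq_addr.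
apply: leq_trans h1.
have -> : e ^ q = e ^ (q - D) * e ^ D by rewrite -expnD subnK.
rewrite [e ^ _ * _]mulnC mulnA leq_mul2r; apply/orP; right.
rewrite -(leq_pmul2r (fact_gt0 D)) bin_ffact.
apply: leq_trans (leq_exp_ffact _ _).
have -> : (q - D) ^ D = (q - D) * (q - D) ^ d := expnS _ _.
have h2 : (q + 2) ^ d <= 2 ^ d * (q - D) ^ d.
  rewrite -expnMn; case: (d) => [|d'] //; rewrite leq_exp2r //; lia.
have h3 : D`! * c * 2 ^ d * e ^ D <= q - D by lia.
apply: leq_trans (leq_mul h3 (leqnn _)).
have := leq_mul (leqnn (D`! * c * e ^ D)) h2.
move: (D`!) (e ^ D) ((q - D) ^ d) (2 ^ d) ((q + 2) ^ d) => f x y z w.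
by congr (_ <= _); lia.
Qed.

(** * Agreement of one permutation with a 2-coset *)

(** Two transpositions force the cells of [x] into the graph; the cells of [s] thereby lost lie in
    their rows and columns. *)
Lemma graph_extend2 n (s : {perm 'I_n}) (i j k l : 'I_n) : i != k -> j != l ->
  let x := [set (i, j); (k, l)] in
  exists w, x :|: (graph s :&: far x) \subset graph w.
Proof.
move=> ik jl x.
pose s1 := (tperm i (s^-1 j) * s)%g; pose w := (tperm k (s1^-1 l) * s1)%g.
have s1i : s1 i = j by rewrite permM tpermL permKV.
have wk : w k = l by rewrite permM tpermL permKV.
have wi : w i = j.
  rewrite permM tpermD // 1?eq_sym //; apply: contra jl => /eqP e.
  by rewrite -s1i e permKV.
exists w; apply/subsetP=> -[a b]; rewrite !inE /=.
case/orP=> [/orP[]/eqP[-> ->]|/and3P[/eqP sab ax bx]]; rewrite ?wi ?wk //.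
have ai : a != i.
  by apply: contra ax => /eqP->; apply/imsetP; exists (i, j); rewrite ?inE ?eqxx.
have ak : a != k.
  by apply: contra ax => /eqP->; apply/imsetP; exists (k, l); rewrite ?inE ?eqxx ?orbT.
have bj : b != j.
  by apply: contra bx => /eqP->; apply/imsetP; exists (i, j); rewrite ?inE ?eqxx.
have bl : b != l.
  by apply: contra bx => /eqP->; apply/imsetP; exists (k, l); rewrite ?inE ?eqxx ?orbT.
have s1a : s1 a = b.
  rewrite permM tpermD // 1?eq_sym //; apply: contra bj => /eqP e.
  by rewrite -sab e permKV.
rewrite permM tpermD ?s1a // 1?eq_sym //; apply: contra bl => /eqP e.
by rewrite -s1a e permKV.
Qed.

Lemma cards2_graph n (w : {perm 'I_n}) (x : {set cell n}) :
  #|x| = 2 -> x \subset graph w ->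
  exists i j k l : 'I_n, [/\ i != k, j != l & x = [set (i, j); (k, l)]].
Proof.
move=> /eqP/cards2P[[i j] [[k l] [pq ->]]] sx; exists i, j, k, l.
have ij : (i, j) \in graph w by apply: (subsetP sx); rewrite !inE eqxx.
have kl : (k, l) \in graph w by apply: (subsetP sx); rewrite !inE eqxx orbT.
split=> //; apply: contra pq => /eqP e; apply/eqP.
  by apply: (graph_fst_inj ij kl).
by apply: (graph_snd_inj ij kl).
Qed.

Section ExactlyOne.
Local Open Scope ring_scope.

(** For [y >= 1] one has [2 - y ^ 2 <= 1 / y], as [1 - 2 * y + y ^ 3 = (y - 1) * (y ^ 2 + y - 1)].
    This gives lower bounds the form required by [poisson_moments]. *)
Lemma two_minus_sq (y p g : rat) : 1 <= y -> 0 <= p -> 0 <= g -> p <= y * g ->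
  2 * p - y ^+ 2 * p <= g.
Proof.
move=> y1 p0 g0 h; rewrite -(ler_pM2l (_ : 0 < y)); last by lra.
apply: le_trans h; rewrite -subr_ge0.
have -> : p - y * (2 * p - y ^+ 2 * p) = p * ((y - 1) * (y * (y - 1) + 2 * (y - 1) + 1)) by ring.
have y2 : 0 <= y - 1 by lra.
apply: mulr_ge0 => //; apply: mulr_ge0 => //.
have : 0 <= y * (y - 1) by apply: mulr_ge0; lra.
lra.
Qed.

(** Agreements with [s] inside the coset are those in [T], at most one, and those in [Z]. As [x] and
    [Z] lie in a common graph, the moments of the latter are exact, and [Z] has between [n - 4] and
    [n - 2] cells. *)
Lemma coset_agree1 n (s w : {perm 'I_n}) (x : {set cell n}) : (1000 <= n)%N ->
  #|x| = 2%N -> x \subset graph w -> ~~ (x \subset graph s) ->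
  #|ext [set: {perm 'I_n}] x|%:R / 10 <=
    #|[set t in ext [set: {perm 'I_n}] x | agree_count s t == 1%N]|%:R :> rat.
Proof.
move=> hn cx xw xs; set P := ext _ x.
have [w' sub] : exists w', x :|: (graph s :&: far x) \subset graph w'.
  have [i [j [k [l [ik jl ->]]]]] := cards2_graph cx xw; exact: graph_extend2.
pose Z := graph s :&: far x; pose T := graph s :&: x.
have cT : (#|T| <= 1)%N.
  have : T \proper x by rewrite properE subsetIr subsetI subxx andbT.
  by move/proper_card; rewrite cx ltnS.
have -> : [set t in P | agree_count s t == 1%N] =
          [set t in P | #|graph t :&: Z| == (1 - #|T|)%N].
  apply/setP=> t; rewrite in_set [RHS]in_set; case tP : (t \in P) => //=.
  have xt : x \subset graph t by move: tP; rewrite !inE.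
  have Ux : T :|: x = x by apply/setUidPr/subsetIr.
  have Ix : T :&: x = T by apply/setIidPl/subsetIr.
  have d1 : [disjoint graph s & x :\: T].
    rewrite -setI_eq0; apply/eqP/setP=> p; rewrite !inE.
    by case: (p \in x); case: (_ == _); rewrite ?andbF.
  have d2 : [disjoint graph t & T :\: x].
    have -> : T :\: x = set0 by apply/eqP; rewrite setD_eq0 subsetIr.
    by rewrite -setI_eq0 setI0.
  rewrite (graphI_split (subsetIl _ _ : T \subset graph s) xt d1 d2) Ux Ix.
  rewrite /Z setIA [graph t :&: _]setIC -[in RHS](eqn_add2r #|T|) subnK //.
apply: poisson_moments; last by rewrite leq_subr.
move=> k /andP[k0 k4].
have cP : #|P| = (n - 2)`! by rewrite (card_extT xw) cx.
rewrite -natr_sum sum_bin_graph.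
have cX (X : {set cell n}) : (X \subset Z) && (#|X| == k) -> #|ext P X| = (n - 2 - k)`!.
  case/andP=> sX /eqP cX; rewrite extU (card_extT (s := w')); last first.
    by apply: subset_trans sub; apply: setUS.
  have dX : [disjoint X & x] by apply: far_disjoint; apply: subset_trans sX (subsetIr _ _).
  by rewrite cardsU setIC disjoint_setI0 // cards0 subn0 cx cX subnDA.
rewrite (eq_bigr _ cX) sum_nat_const.
have -> : #|[pred X : {set cell n} | (X \subset Z) && (#|X| == k)]| = 'C(#|Z|, k).
  by rewrite -cards_draws; apply: eq_card => X; rewrite !inE.
have -> : k`!%:R * ('C(#|Z|, k) * (n - 2 - k)`!)%:R =
    (#|Z| ^_ k)%:R * ((n - 2 - k)`!)%:R :> rat.
  by rewrite -!natrM mulnA [(k`! * _)%N]mulnC bin_ffact.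
have hZ : (n - 4 <= #|Z|)%N.
  by have := card_graph_far s x; rewrite cx.
have hZ2 : (#|Z| <= n - 2)%N.
  have <- : #|graph w' :\: x| = (n - 2)%N.
    rewrite cardsD (_ : graph w' :&: x = x) ?card_graph ?cx //.
    by apply/setIidPr; apply: subset_trans sub; apply: subsetUl.
  apply: subset_leq_card; apply/subsetP=> p pZ; rewrite inE.
  rewrite (subsetP sub) ?andbT; last by rewrite inE pZ orbT.
  have : [disjoint Z & x] by apply: far_disjoint; apply: subsetIr.
  by move/disjointFr => /(_ _ pZ) ->.
have mono a b : (a <= b)%N -> (a ^_ k <= b ^_ k)%N.
  by move=> ab; rewrite -!bin_ffact leq_mul2r leq_bin2l ?orbT.
have eP : (n - 2)`! = ((n - 2) ^_ k * (n - 2 - k)`!)%N by rewrite ffact_fact //; lia.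
have s0 := slack_ge0. have s1 : 1 <= slack by rewrite slackE; lra.
rewrite cP eP natrM; set f := _`!%:R; have f0 : 0 <= f :> rat by [].
apply/andP; split; last first.
  rewrite mulrA; apply: ler_wpM2r => //.
  apply: le_trans (_ : ((n - 2) ^_ k)%:R <= _); first by rewrite ler_nat mono.
  by rewrite -[leLHS]mul1r; apply: ler_wpM2r; rewrite ?exprn_ege1.
rewrite mulnC exprM; apply: two_minus_sq; rewrite ?exprn_ege1 ?mulr_ge0 //.
rewrite mulrA; apply: ler_wpM2r => //.
have n0 : 0 < n%:R :> rat by rewrite ltr0n; lia.
have h : 1 <= (slack / n%:R) ^+ k * ((n - 4) ^_ k)%:R by apply: large_ffact => //; lia.
have nk : 0 < n%:R ^+ k :> rat by rewrite exprn_gt0.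
apply: le_trans (_ : n%:R ^+ k <= _).
  rewrite -natrX ler_nat; apply: leq_trans (leq_ffact_exp _ _) _.
  by rewrite leq_exp2r // leq_subr.
apply: le_trans (_ : slack ^+ k * ((n - 4) ^_ k)%:R <= _).
  by move: h; rewrite expr_div_n mulrAC ler_pdivlMr // mul1r.
by apply: ler_wpM2l; rewrite ?exprn_ge0 // ler_nat mono.
Qed.

End ExactlyOne.

(** A permutation of [A] outside the coset excludes at least a tenth of the coset, leaving [A] at
    most [9 / 10 + 1 / 100] of [(n - 2)!]. *)
Lemma near_coset_bound n (A : {set {perm 'I_n}}) (x : {set cell n}) : 1000 <= n ->
  (forall s t, s \in A -> t \in A -> agree_count s t != 1) -> #|x| = 2 ->
  100 * #|A :\: ext [set: {perm 'I_n}] x| <= (n - 2)`! ->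
  #|A| <= (n - 2)`! /\ (#|A| = (n - 2)`! -> two_coset A).
Proof.
move=> hn hA cx; set P := ext _ x => hR.
have cP : #|P| <= (n - 2)`! by have := card_ext_le [set: {perm 'I_n}] x; rewrite cx.
have f0 : 0 < (n - 2)`! by rewrite fact_gt0.
case: (boolP (A \subset P)) => [sAP|/subsetPn[s sA sP]].
  have cAP := subset_leq_card sAP.
  split=> [|cA]; first exact: leq_trans cAP cP.
  have eAP : A = P by apply/eqP; rewrite eqEcard sAP cA.
  have /card_gt0P[s sA] : 0 < #|A| by rewrite cA.
  have xs : x \subset graph s by move: sA; rewrite eAP !inE.
  have [i [j [k [l [ik jl ex]]]]] := cards2_graph cx xs.
  exists i, k, j, l; split=> //; split=> //; rewrite eAP /P ex; apply/setP=> t.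
  by rewrite !inE subUset !sub1set !inE.
suff lt : #|A| < (n - 2)`! by split=> [|e]; [exact: ltnW|move: lt; rewrite e ltnn].
have cAD := cardsID P A.
have : 10 * #|A :&: P| <= 9 * (n - 2)`!.
  (* [x] may lie in no graph, in which case its coset is empty. *)
  case: (set_0Vmem P) => [->|[w]]; first by rewrite setI0 cards0 muln0.
  rewrite !inE /= => xw.
  have xs : ~~ (x \subset graph s) by move: sP; rewrite !inE.
  set D := [set t in P | agree_count s t == 1].
  have hD : #|P| <= 10 * #|D|.
    have := coset_agree1 hn cx xw xs; rewrite -/P -/D => h.
    by rewrite -(ler_nat rat) natrM; move: h; lra.
  have : #|A :&: P| + #|D| <= #|P|.
    have -> : #|A :&: P| + #|D| = #|(A :&: P) :|: D|.
      rewrite cardsU (_ : _ :&: D = set0) ?cards0 ?subn0 //.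
      apply/setP=> t; rewrite !inE; apply/negP=> /andP[/andP[tA _] /andP[_ st1]].
      by move: (hA _ _ sA tA); rewrite st1.
    apply/subset_leq_card; rewrite subUset subsetIr.
    by apply/subsetP=> t; rewrite inE => /andP[].
  move: cP hD; move: #|P| #|D| #|A :&: P| (n - 2)`! => a b c d; lia.
lia.
Qed.

(** * Choice of [q] and conclusion *)

Lemma choose_scale q0 n : 1000 * (q0 + 1) ^ 3 <= n ->
  exists q, [/\ q0 <= q, 1000 * (q + 1) ^ 3 <= n & n <= 1000 * (q + 2) ^ 3].
Proof.
move=> hn.
have ex : exists q, 1000 * (q + 1) ^ 3 <= n by exists q0.
have ub q : 1000 * (q + 1) ^ 3 <= n -> q <= n.
  apply: leq_trans; rewrite !expnS expn0 muln1; nia.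
case: (ex_maxnP ex ub) => q hq maxq; exists q; split=> //; first exact: maxq.
rewrite leqNgt; apply/negP=> /ltnW h.
by have := maxq q.+1; rewrite (_ : q.+1 + 1 = q + 2) => [/(_ h)|]; rewrite ?ltnn // addSnnS.
Qed.

Theorem theorem1p2 :
  exists n0 : nat, forall n : nat, n0 <= n ->
    forall A : {set {perm 'I_n}},
      (forall s t, s \in A -> t \in A -> agree_count s t != 1) ->
      #|A| <= (n - 2)`! /\ (#|A| = (n - 2)`! -> two_coset A).
Proof.
(* [tau ^+ q] is [101 ^ q / 100 ^ q], and [n ^ 2] will be at most [1000 ^ 2 * (q + 2) ^ 6]. *)
have [q0 hq0] := exp_beats_poly 100 (100 * 1000 ^ 2) 6.
exists (1000 * (q0 + 1) ^ 3) => n hn A hA.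
(* [q] is large enough for [tau ^+ q] to reach [100 * n ^ 2], yet [q ^ 3] is at most [n / 1000]. *)
have [q [q0q qn nq]] := choose_scale hn.
have hqn : 1000 * (q + 1) <= n.
  by apply: leq_trans qn; rewrite leq_mul2l !expnS expn0 muln1; nia.
have htau : ((100 * n ^ 2)%:R <= tau ^+ q)%R.
  have p0 : (0 < 100%:R ^+ q :> rat)%R by rewrite exprn_gt0.
  rewrite tauE expr_div_n (ler_pdivlMr _ _ p0) -!natrX -natrM ler_nat.
  apply: leq_trans (hq0 _ q0q); rewrite leq_mul2r; apply/orP; right.
  have n2 : n ^ 2 <= 1000 ^ 2 * (q + 2) ^ 6 by rewrite (expnM _ 3 2) -expnMn leq_exp2r.
  by rewrite -mulnA leq_mul2l n2 orbT.
have hR := remainder_small A hqn htau.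
set K := \bigcup_(S in cores A q) _ in hR.
have cq : {in cores A q, forall S : {set cell n}, #|S| <= q}.
  by move=> S; rewrite inE => /andP[].
case: (two_intersecting_cover cq (cores_intersect hqn hA)) => [[x cx hx]|].
  apply: (near_coset_bound (x := x)) => //; first by lia.
  apply: leq_trans hR; rewrite leq_mul2l subset_leq_card ?orbT //.
  apply: setDS; apply/bigcupsP=> S SF; apply/subsetP=> s; rewrite !inE.
  exact: subset_trans (hx _ SF).
rewrite -/K => cK.
have q3 : 1000 * q ^ 3 <= n.
  by apply: leq_trans qn; rewrite leq_mul2l leq_exp2r // leq_addr.
have eF : (n - 2)`! = (n - 2) * (n - 3)`!.
  by have [m ->] : (exists m, n = m.+3) by [exists (n - 3); lia]; rewrite !subSS !subn0 factS.
have f0 : 0 < (n - 3)`! by rewrite fact_gt0.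
have cA : #|A| <= #|K| + #|A :\: K|.
  by rewrite -(cardsID K A) leq_add2r subset_leq_card ?subsetIr.
suff lt : #|A| < (n - 2)`! by split=> [|e]; [exact: ltnW|move: lt; rewrite e ltnn].
(* The cosets hold at most a tenth, and the remainder a hundredth, of [(n - 2)!]. *)
have h10 : 10 * (q ^ 3 * (n - 3)`!) <= (n - 2)`!.
  rewrite eF mulnA leq_mul2r; apply/orP; right; lia.
have F0 : 0 < (n - 2)`! by rewrite fact_gt0.
lia.
Qed.
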